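(* Let $\alpha,\beta\in(-\infty,1)$, let $T:\mathcal H\to\mathcal H$ be an $\alpha$-demicontraction and $U:\mathcal H\to\mathcal H$ be a $\beta$-demicontraction with $\operatorname{Fix}T\cap\operatorname{Fix}U\neq\emptyset$. (i) If $\alpha+\beta<\alpha\beta$, then $UT$ is a $\gamma^*$-demicontraction, where $\gamma^*:=\frac{\alpha\beta}{\alpha+\beta}$. If, additionally, (a) $\alpha,\beta<0$, then $\gamma^*<0$ and $UT$ is $(-\gamma^* )$-SQNE; (b) $\alpha\beta<0$, then $\gamma^*\in(0,1)$. Moreover, if $\dim\mathcal H\ge2$, then the constant $\gamma^*$ is optimal, i.e. for arbitrary $\rho\in(-\infty,\gamma^* )$ there are an $\alpha$-demicontraction $T:\mathcal H\to\mathcal H$ and a $\beta$-demicontraction $U:\mathcal H\to\mathcal H$ with $\operatorname{Fix}T\cap\operatorname{Fix}U\neq\emptyset$ such that $UT$ is not a $\rho$-demicontraction. (ii) If $\alpha+\beta<0$, then $\operatorname{Fix}UT=\operatorname{Fix}T\cap\operatorname{Fix}U$. (iii) Suppose that $\alpha+\beta>\alpha\beta$. If $\alpha+\beta\le0$ and $\dim\mathcal H\ge2$, or if $\alpha+\beta>0$, then there are an $\alpha$-demicontraction $T:\mathcal H\to\mathcal H$ and a $\beta$-demicontraction $U:\mathcal H\to\mathcal H$ with $\operatorname{Fix}T\cap\operatorname{Fix}U\neq\emptyset$ such that $UT$ is not a demicontraction. (iv) If $\alpha+\beta\ge0$, then there are an $\alpha$-demicontraction $T:\mathcal H\to\mathcal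 H$ and a $\beta$-demicontraction $U:\mathcal H\to\mathcal H$ with $\operatorname{Fix}T\cap\operatorname{Fix}U\neq\emptyset$ such that $\operatorname{Fix}UT\neq\operatorname{Fix}T\cap\operatorname{Fix}U$. (v) Suppose that $T$ and $U$ satisfy the demi closedness principle. If $\alpha+\beta<0$, then $UT$ also satisfies the demi closedness principle, and, provided that $\alpha+\beta\neq\alpha\beta$, so does $(UT)_{1/\nu^*}$, where $\nu^*:=\frac{2(\alpha+\beta)}{\alpha+\beta-\alpha\beta}$.
   Context: $\mathcal H$ is a real Hilbert space with $\mathcal H\neq\{0\}$; $UT$ denotes the composition $U\circ T$; $\operatorname{Fix}T:=\{z\in\mathcal H:T(z)=z\}$. For $\alpha\in(-\infty,1)$, an operator $T:\mathcal H\to\mathcal H$ with $\operatorname{Fix}T\neq\emptyset$ is an $\alpha$-demicontraction if $\|T(x)-z\|^2\le\|x-z\|^2+\alpha\|T(x)-x\|^2$ for all $x\in\mathcal H$, $z\in\operatorname{Fix}T$; it is a demicontraction if it is an $\alpha$-demicontraction for some $\alpha\in(-\infty,1)$. For $\rho\ge0$, $T$ with $\operatorname{Fix}T\neq\emptyset$ is $\rho$-strongly quasi-nonexpansive ($\rho$-SQNE) if $\|T(x)-z\|^2\le\|x-z\|^2-\rho\|T(x)-x\|^2$ for all $x\in\mathcal H$, $z\in\operatorname{Fix}T$. For a real number $\rho\neq0$ and an operator $S$, $S_\rho:=\operatorname{Id}+\rho(S-\operatorname{Id})$. An operator $T$ satisfies the demi closedness principle if for any bounded sequence $\{x^k\}$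 with $\|T(x^k)-x^k\|\to0$, every weak cluster point of $\{x^k\}$ belongs to $\operatorname{Fix}T$. *)

(* Defs.v *)
From HB Require Import structures.
From mathcomp Require Import all_boot all_order all_algebra.
From mathcomp Require Import all_classical all_reals all_analysis.

Set Implicit Arguments.
Unset Strict Implicit.
Unset Printing Implicit Defensive.

Import Order.TTheory GRing.Theory Num.Theory.
Import numFieldNormedType.Exports.

Local Open Scope classical_set_scope.
Local Open Scope ring_scope.

(* A real Hilbert space: a complete normed space over R whose norm is induced
   by an inner product; [{dot H for idfun}] is the type of symmetric bilinear
   positive definite forms on H. *)
HB.mixin Record CompleteNormedModule_isHilbert (R : realType) H
    of CompleteNormedModule R H := {
  inner : {dot H for idfun} ;
  inner_norm : forall x : H, inner x x = `|x| ^+ 2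
}.

#[short(type="hilbertType")]
HB.structure Definition Hilbert (R : realType) :=
  {H of CompleteNormedModule R H & CompleteNormedModule_isHilbert R H}.

Definition dim_ge (R : realType) (H : hilbertType R) (n : nat) : Prop :=
  exists e : 'I_n -> H, forall c : 'I_n -> R,
    \sum_(i < n) c i *: e i = 0 -> forall i, c i = 0.

Definition fixed_points (H : Type) (T : H -> H) : set H := [set z | T z = z].

Definition demicontraction_with (R : realType) (H : hilbertType R)
    (alpha : R) (T : H -> H) : Prop :=
  [/\ alpha < 1,
      fixed_points T !=set0 &
      forall x z : H, fixed_points T z ->
        `|T x - z| ^+ 2 <= `|x - z| ^+ 2 + alpha * `|T x - x| ^+ 2].

Definition demicontraction (R : realType) (H : hilbertType R)
    (T : H -> H) : Prop :=
  exists alpha : R, demicontraction_with alpha T.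

Definition SQNE_with (R : realType) (H : hilbertType R)
    (rho : R) (T : H -> H) : Prop :=
  [/\ 0 <= rho,
      fixed_points T !=set0 &
      forall x z : H, fixed_points T z ->
        `|T x - z| ^+ 2 <= `|x - z| ^+ 2 - rho * `|T x - x| ^+ 2].

Definition relaxation (R : realType) (H : hilbertType R)
    (rho : R) (S : H -> H) : H -> H :=
  fun x => x + rho *: (S x - x).

Definition weak_cvg (R : realType) (H : hilbertType R)
    (u : nat -> H) (p : H) : Prop :=
  forall y : H, (inner (u k) y : R) @[k --> \oo] --> (inner p y : R).

(* [increasing_seq] is strict monotonicity, so [phi] extracts a subsequence. *)
Definition weak_cluster_point (R : realType) (H : hilbertType R)
    (u : nat -> H) (p : H) : Prop :=
  exists2 phi : nat -> nat, increasing_seq phi & weak_cvg (u \o phi) p.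

Definition demiclosedness_principle (R : realType) (H : hilbertType R)
    (T : H -> H) : Prop :=
  forall u : nat -> H, bounded_fun u ->
    `|T (u k) - u k| @[k --> \oo] --> (0 : R) ->
    forall p : H, weak_cluster_point u p -> fixed_points T p.

Definition gamma_star (R : realType) (alpha beta : R) : R :=
  alpha * beta / (alpha + beta).

Definition nu_star (R : realType) (alpha beta : R) : R :=
  2 * (alpha + beta) / (alpha + beta - alpha * beta).

(* Main.v *)
Require Import Defs.
From HB Require Import structures.
From mathcomp Require Import all_boot all_order all_algebra.
From mathcomp Require Import all_classical all_reals all_analysis.
From mathcomp Require Import ring lra.

(** Write [a] and [b] for the displacements of [T] at [x] and of [U] at [T x],
    and let [z] be a common fixed point. Adding the two defining inequalities
    gives [comp_demicontraction_le]:
      |UTx - z|^2 <= |x - z|^2 + alpha |a|^2 + beta |b|^2.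
    When [alpha + beta < 0], the quadratic form on the right is at most
    [gamma_star alpha beta * `|a + b| ^+ 2], the difference being a nonnegative
    multiple of the squared norm of [alpha *: a - beta *: b]
    ([sqr_norm_combination_le]). As [alpha + beta < alpha * beta] forces
    [alpha + beta < 0] ([add_lt0_of_lt_mul]), this is the demicontraction
    property of the composition. The same estimate with
    [a + b = 0] forces [a = 0], hence identifies the fixed points, and with
    [a + b] small it makes [a] small on bounded sets ([sqr_displacement_le]),
    which gives the demiclosedness principle.

    For the examples, a demicontraction fixing 0 is constrained at one point [x]
    only by [2 * inner x a + (1 - alpha) * `|a| ^+ 2 <= 0], where [a] is its
    displacement ([demicontraction_through]). A pair [T], [U] is thus replaced by
    vectors [x], [a], [b] subject to two such inequalities
    ([demicontractions_through]), and each negative claim becomes the choice of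
    such vectors, on a line when the sign of [alpha + beta] allows it and in a
    plane otherwise. *)

Set Implicit Arguments.
Unset Strict Implicit.
Unset Printing Implicit Defensive.

Import Order.TTheory GRing.Theory Num.Theory.
Import numFieldNormedType.Exports.

Local Open Scope classical_set_scope.
Local Open Scope ring_scope.

(** * Inner product identities *)

Section Inner.
Variables (R : realType) (H : hilbertType R).
Implicit Types (x y z : H) (k : R).

Lemma innerDr x y z : inner x (y + z) = inner x y + inner x z :> R.
Proof. exact: linearDr. Qed.

Lemma innerZr x y k : inner x (k *: y) = k * inner x y :> R.
Proof. exact: linearZr_LR. Qed.

Lemma innerC x y : inner x y = inner y x :> R.
Proof. by rewrite hermC expr0 mul1r. Qed.

Lemma innerDl x y z : inner (x + y) z = inner x z + inner y z :> R.
Proof. by rewrite innerC innerDr !(innerC z). Qed.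

Lemma innerZl x y k : inner (k *: x) y = k * inner x y :> R.
Proof. by rewrite innerC innerZr innerC. Qed.

Lemma innerNl x y : inner (- x) y = - inner x y :> R.
Proof. by rewrite -scaleN1r innerZl mulN1r. Qed.

Lemma innerNr x y : inner x (- y) = - inner x y :> R.
Proof. by rewrite innerC innerNl innerC. Qed.

Definition innerE := (innerDl, innerDr, innerNl, innerNr, innerZl, innerZr).

Lemma normD_sqr x y :
  `|x + y| ^+ 2 = `|x| ^+ 2 + 2 * inner x y + `|y| ^+ 2 :> R.
Proof. by rewrite -!inner_norm !innerE (innerC y x); ring. Qed.

(** Cauchy-Schwarz follows from the triangle inequality, since the norm comes
    from the inner product: square [`|x + y| <= `|x| + `|y|] and cancel. *)
Lemma inner_le_norm x y : `|inner x y : R| <= `|x| * `|y|.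
Proof.
have half z : inner z y <= `|z| * `|y| :> R.
  have := ler_normD z y; rewrite -ler_sqr ?nnegrE ?addr_ge0// normD_sqr.
  nra.
rewrite ler_norml half andbT.
by have := half (- x); rewrite normrN innerNl; lra.
Qed.

(** Gram-Schmidt on two independent vectors. The plane is given by the
    parametrization [P] of an isometric copy of R^2 so that, in the planar
    examples, every inner product is computed in coordinates. *)
Lemma dim2_plane : dim_ge H 2 ->
  exists P : R -> R -> H,
    forall s t s' t', inner (P s t) (P s' t') = s * s' + t * t' :> R.
Proof.
move=> [v v_free].
pose e := v ord0; pose w := v ord_max.
have free s t : s *: e + t *: w = 0 -> s = 0 /\ t = 0.
  move=> st0; pose c (i : 'I_2) := if i == ord0 then s else t.
  have c0 : forall i, c i = 0.
    apply: v_free; rewrite big_ord_recl big_ord1 -st0 /c/=.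
    by congr (_ + _ *: v _); apply/val_inj.
  by split; [have := c0 ord0|have := c0 ord_max].
have e_neq0 : e != 0.
  apply/eqP => e0; have [] := free 1 0; rewrite ?e0 ?scaler0 ?scale0r ?addr0//.
  by move/eqP; rewrite oner_eq0.
pose f := w - (inner e w / inner e e) *: e.
have f_neq0 : f != 0.
  apply/eqP => f0; have [] := free (- (inner e w / inner e e)) 1.
    by rewrite scale1r addrC scaleNr.
  by move=> _ /eqP; rewrite oner_eq0.
have ee : inner e e = `|e| ^+ 2 :> R by exact: inner_norm.
have ff : inner f f = `|f| ^+ 2 :> R by exact: inner_norm.
have ne : `|e| != 0 :> R by rewrite normr_eq0.
have nf : `|f| != 0 :> R by rewrite normr_eq0.
have ef : inner e f = 0 :> R.
  rewrite /f !innerE ee; field; exact: ne.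
clearbody e f.
exists (fun s t => (s / `|e|) *: e + (t / `|f|) *: f) => s t s' t'.
rewrite !innerE (innerC f e) ef ee ff; field.
by rewrite ne nf.
Qed.
End Inner.

(** * Demicontractions through a prescribed point *)

Lemma addrBK (V : zmodType) (x y : V) : x + y - x = y.
Proof. by rewrite addrC addKr. Qed.

Section Displacement.
Variables (R : realType) (H : hilbertType R).
Implicit Types (x y z : H) (T U : H -> H) (alpha beta : R).

(** Expanding the square, the demicontraction inequality becomes a condition on
    the displacement [T x - x] and the base point alone; it is this form that
    is tested on examples. *)
Lemma displacement_leE alpha T x z :
  (`|T x - z| ^+ 2 <= `|x - z| ^+ 2 + alpha * `|T x - x| ^+ 2) =
  (2 * inner (x - z) (T x - x) + (1 - alpha) * `|T x - x| ^+ 2 <= 0).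
Proof.
have -> : T x - z = (x - z) + (T x - x) by rewrite [RHS]addrC addrA subrK.
rewrite normD_sqr; apply/idP/idP; lra.
Qed.

(** The inequality of [displacement_leE] at [z = 0] is the only constraint on
    one value of a demicontraction. If [a = 0] the identity will do; otherwise
    [x] is the only exceptional point, and displacements proportional to [- y]
    at every other [y] make 0 the unique fixed point, so that the inequality
    has to be checked for no other [z]. *)
Lemma demicontraction_through alpha x a : alpha < 1 ->
  2 * inner x a + (1 - alpha) * `|a| ^+ 2 <= 0 ->
  exists T, [/\ demicontraction_with alpha T, T 0 = 0 & T x = x + a].
Proof.
move=> alpha_lt1 xa; have p_gt0 : 0 < 1 - alpha by rewrite subr_gt0.
have [->|a_neq0] := eqVneq a 0.
  exists id; split; rewrite ?addr0//; split=> //; first by exists 0.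
  by move=> y z _; rewrite subrr normr0 expr0n mulr0 addr0.
have x_neq0 : x != 0.
  apply: contraTneq xa => ->.
  rewrite -ltNge -(scale0r (0 : H)) innerZl mul0r mulr0 add0r.
  by rewrite mulr_gt0// exprn_gt0// normr_gt0.
(* A step [- k y] is admissible at every y when 0 < k <= 2 / (1 - alpha). *)
pose k := (1 - alpha)^-1.
pose T y := if y == x then x + a else y - k *: y.
have T0 : T 0 = 0 by rewrite /T eq_sym (negbTE x_neq0) scaler0 subr0.
have fixT z : fixed_points T z -> z = 0.
  rewrite /fixed_points/= /T; have [->|_] := eqVneq z x.
    by move/eqP; rewrite -subr_eq0 addrC addKr (negbTE a_neq0).
  move/eqP; rewrite -subr_eq0 addrC addKr oppr_eq0 scaler_eq0 invr_eq0.
  by rewrite gt_eqF//= => /eqP.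
exists T; split=> //; last by rewrite /T eqxx.
split=> //; first by exists 0.
move=> y z /fixT ->; rewrite displacement_leE subr0 /T.
have [->|_] := eqVneq y x; first by rewrite addrBK.
rewrite addrBK normrN -!inner_norm !innerE.
have -> : (1 - alpha) * (k * (k * inner y y)) = k * inner y y.
  by rewrite /k; field; rewrite gt_eqF.
have : 0 <= k * inner y y by rewrite inner_norm mulr_ge0// invr_ge0 ltW.
lra.
Qed.

(** All the examples come from here: a counterexample amounts to three vectors
    [x], [a], [b] satisfying two inequalities. *)
Lemma demicontractions_through alpha beta x a b : alpha < 1 -> beta < 1 ->
  2 * inner x a + (1 - alpha) * `|a| ^+ 2 <= 0 ->
  2 * inner (x + a) b + (1 - beta) * `|b| ^+ 2 <= 0 ->
  exists T U, [/\ demicontraction_with alpha T, demicontraction_with beta U,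
    [/\ T 0 = 0, U 0 = 0, T x = x + a & U (T x) = x + (a + b)] &
    fixed_points T `&` fixed_points U !=set0].
Proof.
move=> ? ? /demicontraction_through-[]// T [T_demi T0 Tx].
move=> /demicontraction_through-[]// U [U_demi U0 Ux].
exists T, U; split=> //; last by exists 0.
by split=> //; rewrite Tx Ux addrA.
Qed.

Lemma not_demicontraction_with rho T x c : T 0 = 0 -> T x = x + c ->
  0 < 2 * inner x c + (1 - rho) * `|c| ^+ 2 -> ~ demicontraction_with rho T.
Proof.
move=> T0 Tx xc [_ _ /(_ x 0 T0)].
by rewrite displacement_leE subr0 Tx addrBK leNgt xc.
Qed.

End Displacement.

(** * Optimality and counterexamples *)

Section Examples.
Variables (R : realType) (H : hilbertType R) (alpha beta : R).
Hypotheses (alpha_lt1 : alpha < 1) (beta_lt1 : beta < 1).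

(** If [x] makes a non-obtuse angle with the nonzero total displacement, then
    the composition violates the inequality for every constant below 1. *)
Lemma not_demicontraction_of_ge0 (x a b : H) :
  2 * inner x a + (1 - alpha) * `|a| ^+ 2 <= 0 ->
  2 * inner (x + a) b + (1 - beta) * `|b| ^+ 2 <= 0 ->
  a + b != 0 -> 0 <= inner x (a + b) :> R ->
  exists T U : H -> H,
    [/\ demicontraction_with alpha T, demicontraction_with beta U,
        fixed_points T `&` fixed_points U !=set0 & ~ demicontraction (U \o T)].
Proof.
move=> xa yb ab_neq0 xab.
have [T [U [T_demi U_demi [T0 U0 Tx UTx] TU]]] :=
  demicontractions_through alpha_lt1 beta_lt1 xa yb.
exists T, U; split=> // -[rho UT_demi]; have [rho_lt1 _ _] := UT_demi.
apply: (not_demicontraction_with (T := U \o T) _ UTx _ UT_demi).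
  by rewrite /= T0.
by rewrite ltr_wpDl ?mulr_ge0// mulr_gt0 ?exprn_gt0 ?normr_gt0// subr_gt0.
Qed.

(** Equality in the upper bound would require both displacement inequalities to
    be equalities and [alpha *: a = beta *: b]. When [a] and [b] are parallel
    and nonzero these conditions on [x] are inconsistent, so [b] is tilted by a
    small [eps] out of the direction of [a]; then [x] exists, with a second
    coordinate at most of order [eps^-1], and the bound is missed by a term of
    order [eps ^+ 2]. *)
Lemma optimality_example : alpha + beta < 0 -> dim_ge H 2 ->
  forall rho, rho < gamma_star alpha beta ->
  exists T U : H -> H,
    [/\ demicontraction_with alpha T, demicontraction_with beta U,
        fixed_points T `&` fixed_points U !=set0 &
        ~ demicontraction_with rho (U \o T)].
Proof.
move=> ab_lt0 /dim2_plane[P PP] rho rho_lt.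
pose d := (gamma_star alpha beta - rho) * (alpha + beta) ^+ 2.
have d_gt0 : 0 < d by rewrite mulr_gt0 ?subr_gt0// exprn_even_gt0//= lt_eqF.
(* [d] is the gain available at eps = 0, and [eps] is so small that the loss
   (rho - beta) * eps^2 stays below it. *)
pose eps := Num.sqrt (d / (1 + `|rho - beta|)).
have den_gt0 : 0 < 1 + `|rho - beta| by rewrite ltr_pwDl.
have eps_gt0 : 0 < eps by rewrite sqrtr_gt0 divr_gt0.
have eps_small : (rho - beta) * eps ^+ 2 < d.
  rewrite sqr_sqrtr; last by rewrite ltW// divr_gt0.
  rewrite mulrA ltr_pdivrMr// mulrC ltr_pM2l//.
  by rewrite (le_lt_trans (ler_norm _))// ltrDr.
have d_eq : d = alpha * beta * (alpha + beta) - rho * (alpha + beta) ^+ 2.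
  by rewrite /d /gamma_star; field; rewrite lt_eqF.
(* [s] and [t] turn the two displacement inequalities into equalities. *)
pose s := - (1 - alpha) * beta / 2.
pose t := - (2 * (s * alpha + alpha * beta) +
             (1 - beta) * (alpha ^+ 2 + eps ^+ 2)) / (2 * eps).
have t_eq : 2 * (t * eps) = - (2 * (s * alpha + alpha * beta) +
             (1 - beta) * (alpha ^+ 2 + eps ^+ 2)).
  by rewrite /t; field; rewrite gt_eqF.
have [||T [U [T_demi U_demi [T0 U0 Tx UTx] TU]]] :=
  @demicontractions_through R H alpha beta (P s t) (P beta 0) (P alpha eps)
    alpha_lt1 beta_lt1.
- by rewrite -!inner_norm !PP /s; lra.
- by rewrite -!inner_norm !innerE !PP; lra.
exists T, U; split=> //; apply: (not_demicontraction_with (T := U \o T) _ UTx).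
  by rewrite /= T0.
rewrite -!inner_norm !innerE !PP.
move: eps_small t_eq; rewrite d_eq /s; nra.
Qed.

(** On a line: take the longest admissible step from [e] through the fixed point
    0, then the longest admissible step back. As [(1 - alpha) + (1 - beta) < 2],
    the way back is longer and the composition moves [e] away from 0. *)
Lemma line_example (H_neq0 : exists x : H, x != 0) : 0 < alpha + beta ->
  exists T U : H -> H,
    [/\ demicontraction_with alpha T, demicontraction_with beta U,
        fixed_points T `&` fixed_points U !=set0 & ~ demicontraction (U \o T)].
Proof.
have [e e_neq0] := H_neq0 => ab_gt0.
have p_gt0 : 0 < 1 - alpha by rewrite subr_gt0.
have q_gt0 : 0 < 1 - beta by rewrite subr_gt0.
have ee_gt0 : 0 < inner e e :> R by rewrite inner_norm exprn_gt0// normr_gt0.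
pose a : R := - 2 / (1 - alpha).
pose b : R := 2 * (1 + alpha) / ((1 - alpha) * (1 - beta)).
have pa : (1 - alpha) * a = - 2 by rewrite /a; field; rewrite gt_eqF.
have qb : (1 - beta) * b = - 2 * (1 + a).
  by rewrite /a /b; field; rewrite !gt_eqF.
have ab : 0 < a + b.
  have -> : a + b = 2 * (alpha + beta) / ((1 - alpha) * (1 - beta)).
    by rewrite /a /b; field; rewrite !gt_eqF.
  by rewrite divr_gt0 ?mulr_gt0.
apply: (@not_demicontraction_of_ge0 e (a *: e) (b *: e)).
- rewrite -!inner_norm !innerE.
  have -> : 2 * (a * inner e e) + (1 - alpha) * (a * (a * inner e e)) =
            (2 + (1 - alpha) * a) * (a * inner e e) by ring.
  by rewrite pa; lra.
- rewrite -!inner_norm !innerE.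
  have -> : 2 * (b * inner e e + a * (b * inner e e)) +
            (1 - beta) * (b * (b * inner e e)) =
            (2 * (1 + a) + (1 - beta) * b) * (b * inner e e) by ring.
  by rewrite qb; lra.
- by rewrite -scalerDl scaler_eq0 negb_or gt_eqF.
- by rewrite -scalerDl innerE ltW// mulr_gt0.
Qed.

(** In the plane: choose [x] orthogonal to [a + b] with equality in both
    displacement inequalities. This forces
    [(1 - alpha) |a|^2 + 2 <a, b> + (1 - beta) |b|^2 = 0], which has solutions
    with [a] and [b] independent because [(1 - alpha) * (1 - beta) < 1]. *)
Lemma plane_example : alpha * beta < alpha + beta -> dim_ge H 2 ->
  exists T U : H -> H,
    [/\ demicontraction_with alpha T, demicontraction_with beta U,
        fixed_points T `&` fixed_points U !=set0 & ~ demicontraction (U \o T)].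
Proof.
move=> ab_lt /dim2_plane[P PP].
have q_gt0 : 0 < 1 - beta by rewrite subr_gt0.
pose v := Num.sqrt (1 - (1 - alpha) * (1 - beta)) / (1 - beta).
have pq : 0 < 1 - (1 - alpha) * (1 - beta) by lra.
have v_gt0 : 0 < v by rewrite divr_gt0// sqrtr_gt0.
have vv : v ^+ 2 = (1 - (1 - alpha) * (1 - beta)) / (1 - beta) ^+ 2.
  by rewrite expr_div_n sqr_sqrtr// ltW.
pose u := - (1 - beta)^-1.
pose s := - (1 - alpha) / 2.
pose t := - (1 + u) * s / v.
have tv : t * v = - (1 + u) * s by rewrite /t; field; rewrite gt_eqF.
have norm_b : (1 - beta) * (u * u + v * v) + 2 * u + (1 - alpha) = 0.
  by rewrite -(expr2 v) vv /u; field; rewrite gt_eqF.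
apply: (@not_demicontraction_of_ge0 (P s t) (P 1 0) (P u v)).
- by rewrite -!inner_norm !PP /s; lra.
- by rewrite -!inner_norm !innerE !PP tv; move: norm_b; rewrite /s; lra.
- apply/eqP => /(congr1 (fun y => inner y (P 0 1) : R)).
  rewrite -(scale0r (0 : H)) !innerE !PP; lra.
- by rewrite innerE !PP tv; lra.
Qed.

(** The step of [U] undoes that of [T], which creates a fixed point of the
    composition; the two displacement inequalities are compatible exactly when
    [alpha + beta] is nonnegative. *)
Lemma fixed_point_example (H_neq0 : exists x : H, x != 0) : 0 <= alpha + beta ->
  exists T U : H -> H,
    [/\ demicontraction_with alpha T, demicontraction_with beta U,
        fixed_points T `&` fixed_points U !=set0 &
        fixed_points (U \o T) <> fixed_points T `&` fixed_points U].
Proof.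
have [e e_neq0] := H_neq0 => ab_ge0.
have ee_gt0 : 0 < inner e e :> R by rewrite inner_norm exprn_gt0// normr_gt0.
have [||T [U [T_demi U_demi [T0 U0 Tx UTx] TU]]] :=
  @demicontractions_through R H alpha beta (((alpha - 1) / 2) *: e) e (- e)
    alpha_lt1 beta_lt1.
- by rewrite -!inner_norm !innerE; lra.
- by rewrite normrN -!inner_norm !innerE; nra.
exists T, U; split=> // fixE; pose x := ((alpha - 1) / 2) *: e.
have : fixed_points (U \o T) x by rewrite /fixed_points/= UTx subrr addr0.
rewrite fixE => -[+ _]; rewrite /fixed_points/= Tx => xe.
by move: e_neq0; rewrite -(addrBK x e) xe subrr eqxx.
Qed.
End Examples.

(** * The composition of two demicontractions *)

Lemma increasing_seq_cvgny (phi : nat -> nat) :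
  increasing_seq phi -> phi k @[k --> \oo] --> \oo.
Proof.
move=> phi_incr; have phi_ge k : (k <= phi k)%N.
  elim: k => // k IHk; apply: leq_ltn_trans IHk _.
  by rewrite ltnNge -leEnat phi_incr ltnn.
by apply/cvgnyPge => A; exists A => // k /= /leq_trans; apply; exact: phi_ge.
Qed.

(** The hypothesis reads [(1 - alpha) * (1 - beta) > 1], so by the inequality
    between arithmetic and geometric means [(1 - alpha) + (1 - beta) > 2]. *)
Lemma add_lt0_of_lt_mul (R : realFieldType) (alpha beta : R) :
  alpha < 1 -> beta < 1 -> alpha + beta < alpha * beta -> alpha + beta < 0.
Proof.
move=> alpha_lt1 beta_lt1; apply: contraLR; rewrite -!leNgt => ab_ge0.
have := sqr_ge0 (alpha - beta); nra.
Qed.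

Section Composition.
Variables (R : realType) (H : hilbertType R) (alpha beta : R) (T U : H -> H).
Hypotheses (T_demi : demicontraction_with alpha T)
  (U_demi : demicontraction_with beta U).

(** The defining inequalities of [T] at [x] and of [U] at [T x] add up. Every
    positive result on the composition is read off from this estimate. *)
Lemma comp_demicontraction_le x z : (fixed_points T `&` fixed_points U) z ->
  `|U (T x) - z| ^+ 2 <=
    `|x - z| ^+ 2 + alpha * `|T x - x| ^+ 2 + beta * `|U (T x) - T x| ^+ 2.
Proof.
move=> [Tz Uz]; have [_ _ /(_ x z Tz) T_le] := T_demi.
have [_ _ /(_ (T x) z Uz) U_le] := U_demi.
by rewrite (le_trans U_le)// lerD2r.
Qed.

(** At a fixed point of the composition the displacements of [T] and [U] are
    opposite, and the estimate leaves
    [0 <= (alpha + beta) * `|T x - x| ^+ 2]. *)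
Lemma fixed_points_comp : alpha + beta < 0 ->
  fixed_points T `&` fixed_points U !=set0 ->
  fixed_points (U \o T) = fixed_points T `&` fixed_points U.
Proof.
move=> ab_lt0 [z TUz]; apply/seteqP; split=> x; rewrite /fixed_points/=.
- move=> UTx; have := comp_demicontraction_le x TUz; rewrite UTx.
  rewrite (distrC x (T x)) -addrA -mulrDl lerDl => a_le0.
  have Tx : T x = x.
    apply/eqP; rewrite -subr_eq0 -normr_eq0 -sqrf_eq0 eq_le sqr_ge0 andbT.
    by rewrite -(nmulr_rge0 _ ab_lt0).
  by split=> //; rewrite -{1}Tx.
- by move=> [-> ->].
Qed.

(** After multiplication by [alpha + beta], which is negative, left minus right
    is the squared norm of [alpha *: a - beta *: b]. *)
Lemma sqr_norm_combination_le (a b : H) : alpha + beta < 0 ->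
  alpha * `|a| ^+ 2 + beta * `|b| ^+ 2 <=
    gamma_star alpha beta * `|a + b| ^+ 2.
Proof.
move=> ab_lt0; rewrite -subr_ge0.
rewrite -(nmulr_rle0 _ ab_lt0).
have -> : (alpha + beta) * (gamma_star alpha beta * `|a + b| ^+ 2 -
    (alpha * `|a| ^+ 2 + beta * `|b| ^+ 2)) =
    - `|alpha *: a + - beta *: b| ^+ 2.
  rewrite !normD_sqr -!inner_norm !innerE /gamma_star; field.
  by rewrite lt_eqF.
by rewrite oppr_le0 sqr_ge0.
Qed.

Lemma comp_demicontraction : alpha + beta < alpha * beta ->
  fixed_points T `&` fixed_points U !=set0 ->
  demicontraction_with (gamma_star alpha beta) (U \o T).
Proof.
move=> ab_lt TU0.
have [[alpha_lt1 _ _] [beta_lt1 _ _]] := (T_demi, U_demi).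
have ab_lt0 := add_lt0_of_lt_mul alpha_lt1 beta_lt1 ab_lt.
have fixE := fixed_points_comp ab_lt0 TU0; split.
- by rewrite /gamma_star ltr_ndivrMr// mul1r.
- by rewrite fixE.
move=> x z; rewrite fixE => TUz /=.
apply: le_trans (comp_demicontraction_le x TUz) _.
rewrite -addrA lerD2l (le_trans (sqr_norm_combination_le _ _ ab_lt0))//.
by rewrite [_ - x + _]addrC addrA subrK.
Qed.

(** A quantitative form of [fixed_points_comp]: a small displacement of the
    composition at [x] forces a small displacement of [T], uniformly on bounded
    sets. *)
Lemma sqr_displacement_le x z : alpha + beta < 0 ->
  (fixed_points T `&` fixed_points U) z ->
  (alpha + beta) ^+ 2 * `|T x - x| ^+ 2 <=
    (- 4 * (alpha + beta) * `|x - z| + 4 * beta ^+ 2 * `|U (T x) - x|) *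
    `|U (T x) - x|.
Proof.
move=> ab_lt0 TUz; have [beta_lt1 _ _] := U_demi.
have := comp_demicontraction_le x TUz.
set a := T x - x; set c := U (T x) - x.
have -> : U (T x) - z = (x - z) + c by rewrite [RHS]addrC addrA subrK.
have -> : U (T x) - T x = c + - a by rewrite /a opprB addrA subrK.
move: (x - z) => w; clearbody a c; rewrite !normD_sqr normrN innerNr.
have := inner_le_norm w c; have := inner_le_norm c a.
rewrite !ler_norml => /andP[ca1 ca2] /andP[xc1 xc2].
move: (inner c a) (inner w c) ca1 ca2 xc1 xc2 => i j.
have := normr_ge0 a; have := normr_ge0 c.
move: `|a| `|c| `|w| => na nc nx nc0 na0 ca1 ca2 xc1 xc2 le.
have bi : - (2 * beta * i) <= 2 * (`|beta| * (nc * na)).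
  have : `|beta * i| <= `|beta| * (nc * na).
    by rewrite normrM ler_wpM2l// ler_norml ca1 ca2.
  by rewrite ler_norml => /andP[]; lra.
have lin : - (alpha + beta) * na ^+ 2 <=
    2 * (nx * nc) + 2 * (`|beta| * (nc * na)).
  have : 0 <= (1 - beta) * nc ^+ 2 by rewrite mulr_ge0 ?sqr_ge0// subr_ge0 ltW.
  lra.
(* The term linear in na is absorbed by completing this square. *)
have := sqr_ge0 ((alpha + beta) * na + 2 * `|beta| * nc).
have -> : beta ^+ 2 = `|beta| ^+ 2 by rewrite real_normK// num_real.
have : - (alpha + beta) * (- (alpha + beta) * na ^+ 2) <=
    - (alpha + beta) * (2 * (nx * nc) + 2 * (`|beta| * (nc * na))).
  by rewrite ler_wpM2l// oppr_ge0 ltW.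
lra.
Qed.

Lemma displacement_cvg0 (u : nat -> H) : alpha + beta < 0 ->
  fixed_points T `&` fixed_points U !=set0 -> bounded_fun u ->
  `|U (T (u k)) - u k| @[k --> \oo] --> (0 : R) ->
  T (u k) - u k @[k --> \oo] --> (0 : H).
Proof.
move=> ab_lt0 [z TUz] /pinfty_ex_gt0[M M_gt0 uM] c0.
pose f k := ((- 4 * (alpha + beta) * (M + `|z|) +
   4 * beta ^+ 2 * `|U (T (u k)) - u k|) * `|U (T (u k)) - u k|).
have f0 : f k @[k --> \oo] --> (0 : R).
  rewrite -(mulr0 (- 4 * (alpha + beta) * (M + `|z|) + 4 * beta ^+ 2 * 0)).
  apply: (cvgM _ c0); apply: cvgD; [exact: cvg_cst|exact: cvgM (cvg_cst _) c0].
apply/norm_cvg0P.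
have s0 : Num.sqrt (f k / (alpha + beta) ^+ 2) @[k --> \oo] --> (0 : R).
  rewrite -sqrtr0 -(mul0r ((alpha + beta) ^- 2)).
  by apply: (cvg_comp _ _ (cvgM f0 (cvg_cst _))); exact: sqrt_continuous.
apply: (squeeze_cvgr _ (cvg_cst 0) s0).
near=> k; rewrite normr_ge0/= -[leLHS]normr_id -sqrtr_sqr.
apply: ler_wsqrtr.
rewrite ler_pdivlMr ?exprn_even_gt0//= ?lt_eqF// mulrC.
apply: le_trans (sqr_displacement_le _ ab_lt0 TUz) _.
rewrite /f ler_wpM2r// lerD2r ler_wpM2l//; first by lra.
by rewrite (le_trans (ler_normB _ _))// lerD2r; exact: uM.
Unshelve. all: by end_near. Qed.

(** By [displacement_cvg0] the displacements of [T] along [u], hence those of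
    [U] along [T \o u], tend to 0. So [T \o u] is bounded with the same weak
    cluster points as [u], and both principles apply to [p]. *)
Lemma demiclosedness_comp : alpha + beta < 0 ->
  fixed_points T `&` fixed_points U !=set0 ->
  demiclosedness_principle T -> demiclosedness_principle U ->
  demiclosedness_principle (U \o T).
Proof.
move=> ab_lt0 TU0 T_dc U_dc u u_bnd /= c0 p [phi phi_incr u_p].
have a0 := displacement_cvg0 ab_lt0 TU0 u_bnd c0.
have na0 : `|T (u k) - u k| @[k --> \oo] --> (0 : R) by apply/norm_cvg0P.
rewrite fixed_points_comp//; split.
  by apply: T_dc na0 _ _ => //; exists phi.
apply: (U_dc (T \o u)).
- have /pinfty_ex_gt0[M M_gt0 uM] := u_bnd.
  have /pinfty_ex_gt0[N N_gt0 aN] : bounded_fun (fun k => T (u k) - u k).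
    by apply: cvg_seq_bounded; apply/cvg_ex; exists 0.
  exists (M + N); split; first exact: num_real.
  move=> B /ltW MN_le k _ /=; apply: le_trans MN_le.
  rewrite -(subrK (u k) (T (u k))) addrC (le_trans (ler_normD _ _))//.
  by apply: lerD; [exact: uM|exact: aN].
- have s0 : `|U (T (u k)) - u k| + `|T (u k) - u k| @[k --> \oo] --> (0 : R).
    by rewrite -(addr0 0); exact: cvgD.
  apply: (squeeze_cvgr _ (cvg_cst 0) s0).
  near=> k; rewrite normr_ge0/= (distrC (T _) (u k)).
  exact: ler_distD.
- exists phi => // y.
  have -> : inner p y = inner p y + 0 :> R by rewrite addr0.
  have -> : (fun k => inner ((T \o u \o phi) k) y : R) =
      (fun k => inner (u (phi k)) y + inner (T (u (phi k)) - u (phi k)) y : R).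
    by apply/funext => k; rewrite -innerDl addrC subrK.
  apply: cvgD; first exact: u_p.
  have phi_oo : phi k @[k --> \oo] --> \oo.
    exact: increasing_seq_cvgny.
  have s0 : `|T (u (phi k)) - u (phi k)| * `|y| @[k --> \oo] --> (0 : R).
    rewrite -(mul0r `|y|); apply: cvgM (cvg_cst _).
    exact: (cvg_comp _ _ phi_oo na0).
  apply/norm_cvg0P; apply: (squeeze_cvgr _ (cvg_cst 0) s0).
  by near=> k; rewrite normr_ge0 inner_le_norm.
Unshelve. all: by end_near. Qed.

End Composition.

(** The displacements of the relaxation are those of [S] multiplied by [rho]. *)
Lemma demiclosedness_relaxation (R : realType) (H : hilbertType R) (rho : R)
    (S : H -> H) : rho != 0 ->
  demiclosedness_principle S -> demiclosedness_principle (relaxation rho S).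
Proof.
move=> rho_neq0 S_dc u u_bnd Su0 p up.
have relax_fix x : S x = x -> relaxation rho S x = x.
  by move=> Sx; rewrite /relaxation Sx subrr scaler0 addr0.
apply: relax_fix; apply: (S_dc u u_bnd _ p up).
have -> : (fun k => `|S (u k) - u k| : R) =
    (fun k => `|rho|^-1 * `|relaxation rho S (u k) - u k|).
  apply/funext => k; rewrite /relaxation addrBK normrZ mulKf//.
  by rewrite normr_eq0.
by rewrite -(mulr0 `|rho|^-1); exact: cvgM (cvg_cst _) Su0.
Qed.

(** * The composition theorem *)

Theorem corollary3p9 (R : realType) (H : hilbertType R)
  (H_neq0 : exists x : H, x != 0)
  (alpha beta : R) (alpha_lt1 : alpha < 1) (beta_lt1 : beta < 1)
  (T U : H -> H)
  (T_demi : demicontraction_with alpha T)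
  (U_demi : demicontraction_with beta U)
  (TU_common : fixed_points T `&` fixed_points U !=set0) :
  (* (i) *)
  (alpha + beta < alpha * beta ->
     [/\ demicontraction_with (gamma_star alpha beta) (U \o T),
         (alpha < 0 -> beta < 0 ->
            gamma_star alpha beta < 0 /\
            SQNE_with (- gamma_star alpha beta) (U \o T)),
         (alpha * beta < 0 -> 0 < gamma_star alpha beta < 1) &
         (dim_ge H 2 -> forall rho : R, rho < gamma_star alpha beta ->
            exists T' U' : H -> H,
              [/\ demicontraction_with alpha T',
                  demicontraction_with beta U',
                  fixed_points T' `&` fixed_points U' !=set0 &
                  ~ demicontraction_with rho (U' \o T')])]) /\
  (* (ii) *)
  (alpha + beta < 0 ->
     fixed_points (U \o T) = fixed_points T `&` fixed_points U) /\
  (* (iii) *)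
  (alpha * beta < alpha + beta ->
     (alpha + beta <= 0 /\ dim_ge H 2) \/ 0 < alpha + beta ->
     exists T' U' : H -> H,
       [/\ demicontraction_with alpha T',
           demicontraction_with beta U',
           fixed_points T' `&` fixed_points U' !=set0 &
           ~ demicontraction (U' \o T')]) /\
  (* (iv) *)
  (0 <= alpha + beta ->
     exists T' U' : H -> H,
       [/\ demicontraction_with alpha T',
           demicontraction_with beta U',
           fixed_points T' `&` fixed_points U' !=set0 &
           fixed_points (U' \o T') <> fixed_points T' `&` fixed_points U']) /\
  (* (v) *)
  (demiclosedness_principle T -> demiclosedness_principle U ->
     alpha + beta < 0 ->
     demiclosedness_principle (U \o T) /\
     (alpha + beta <> alpha * beta ->
        demiclosedness_principle
          (relaxation (nu_star alpha beta)^-1 (U \o T)))).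
Proof.
split=> [ab_lt|].
  have ab_lt0 := add_lt0_of_lt_mul alpha_lt1 beta_lt1 ab_lt.
  have UT_demi := comp_demicontraction T_demi U_demi ab_lt TU_common.
  have [gamma_lt1 UT_fix UT_le] := UT_demi; split=> //.
  - move=> alpha_lt0 beta_lt0.
    have gamma_lt0 : gamma_star alpha beta < 0.
      by rewrite /gamma_star ltr_ndivrMr// mul0r nmulr_rgt0.
    split=> //; split=> //; first by rewrite oppr_ge0 ltW.
    by move=> x z /(UT_le x); rewrite mulNr opprK.
  - move=> ab_mul_lt0; rewrite gamma_lt1 andbT.
    by rewrite /gamma_star ltr_ndivlMr// mul0r.
  - exact: optimality_example.
split=> [ab_lt0|]; first exact: (fixed_points_comp T_demi U_demi).
split=> [ab_lt [[_ dimH]|ab_gt0]|]; [exact: plane_example|exact: line_example|].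
split; first exact: fixed_point_example.
move=> T_dc U_dc ab_lt0.
have UT_dc := demiclosedness_comp T_demi U_demi ab_lt0 TU_common T_dc U_dc.
split=> // ab_neq; apply: demiclosedness_relaxation UT_dc.
rewrite invr_neq0// /nu_star !mulf_neq0 ?invr_neq0 ?pnatr_eq0//.
  by rewrite lt_eqF.
by rewrite subr_eq0; apply/eqP.
Qed.
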